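(* Let $(M_n)$ be a weight sequence and suppose that $\phi:[0,1]\to[0,1]$ induces a compact endomorphism $T$ of $D([0,1],M)$. Then every non-zero eigenvalue of $T$ has multiplicity $1$, that is, its eigenspace is one-dimensional.
   Context: A weight sequence is a sequence $(M_n)_{n\ge 0}$ of positive real numbers with $M_0=1$ and $\frac{M_{n+m}}{M_nM_m}\ge\binom{n+m}{m}$ for all non-negative integers $m,n$. $D([0,1],M)$ is the set of complex-valued infinitely differentiable functions $f$ on $[0,1]$ (one-sided derivatives at endpoints) with $\|f\|_D=\sum_{n=0}^\infty \frac{\|f^{(n)}\|_\infty}{M_n}<\infty$, where $\|\cdot\|_\infty$ is the supremum norm on $[0,1]$; with pointwise operations and the norm $\|\cdot\|_D$ it is a unital commutative semisimple Banach algebra. A map $\phi:[0,1]\to[0,1]$ induces an endomorphism of $D([0,1],M)$ if $f\circ\phi\in D([0,1],M)$ for every $f\in D([0,1],M)$; the endomorphism is then $T:f\mapsto f\circ\phi$ (automatically continuous), and $\phi$ induces a compact endomorphism if moreover $T$ is a compact operator. The multiplicity of an eigenvalue $\lambda$ of $T$ means the dimension of $\{f\in D([0,1],M): f\circ\phi=\lambda f\}$. *)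

(* Defs.v *)
From HB Require Import structures.
From mathcomp Require Import all_boot all_order all_algebra.
From mathcomp Require Import all_classical all_reals all_analysis.
From mathcomp Require Import complex lra.

Set Implicit Arguments.
Unset Strict Implicit.
Unset Printing Implicit Defensive.

Import Order.TTheory GRing.Theory Num.Theory numFieldNormedType.Exports.
Import Normc.

Local Open Scope classical_set_scope.
Local Open Scope ring_scope.
Local Open Scope complex_scope.

Section linear_operators.
Variables (K : numFieldType) (X Y : normedModType K).

Definition compact_operator (T : {linear X -> Y}) : Prop :=
  compact (closure (T @` [set x | `|x| <= 1])).

Definition op_eigenspace (T : {linear X -> X}) (a : K) : set X :=
  [set x | T x = a *: x].

Definition op_eigenvalue (T : {linear X -> X}) (a : K) : Prop :=
  exists2 x : X, x != 0 & T x = a *: x.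

(* [e] is a basis of [V] exactly when the coordinate map
   K^n -> X, c |-> \sum_i c_i e_i is a bijection onto [V]. *)
Definition has_dimension (V : set X) (n : nat) : Prop :=
  exists e : 'I_n -> X,
    set_bij [set: {ffun 'I_n -> K}] V (fun c => \sum_(i < n) c i *: e i).

End linear_operators.

Record weight_sequence (R : realType) := WeightSequence {
  weight :> nat -> R ;
  weight0 : weight 0%N = 1 ;
  weight_gt0 : forall n, 0 < weight n ;
  weight_binomial : forall m n,
    ('C(n + m, m))%:R <= weight (n + m)%N / (weight n * weight m) }.

Definition unit_interval (R : realType) : Type := set_type `[0 : R, 1]%classic.

HB.instance Definition _ (R : realType) :=
  PseudoMetric.copy (unit_interval R) (set_type `[0 : R, 1]%classic).

Lemma unit_interval0_subproof (R : realType) : 0 \in `[0 : R, 1]%classic.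
Proof. by rewrite inE /= in_itv /= lexx ler01. Qed.

HB.instance Definition _ (R : realType) := isPointed.Build (unit_interval R)
  (exist _ 0 (unit_interval0_subproof R)).

Section derivatives.
Variable R : realType.
Local Notation I := (unit_interval R).
Implicit Types (f g : I -> R[i]^o) (x : I).

Definition diff_quot f x (y : I) : R[i]^o :=
  (set_val y - set_val x)%:C^-1 * (f y - f x).

(* The filter [x^'] is that of the subspace [0, 1], so that these derivatives
   are one-sided at 0 and at 1. *)
Definition I_derivable f x : Prop := cvg (diff_quot f x y @[y --> x^']).

Definition I_derive f x : R[i]^o := lim (diff_quot f x y @[y --> x^']).

Definition I_derive_n n f : I -> R[i]^o := iter n I_derive f.

Definition I_smooth f : Prop := forall n x, I_derivable (I_derive_n n f) x.

Definition sup_norm f : \bar R := ereal_sup (range (fun x => (normc (f x))%:E)).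

End derivatives.

Section derivative_theory.
Variable R : realType.
Local Notation I := (unit_interval R).
Implicit Types (f g : I -> R[i]^o) (x : I).

Lemma I_dnbhs_proper x : ProperFilter x^'.
Proof.
apply: Build_ProperFilter_ex => A.
rewrite /dnbhs /within /= => -[_ [[B oB <-] /= Bx] BA].
have /nbhs_ballP[e /= e0 eB] : nbhs (set_val x) B by exact: open_nbhs_nbhs.
have x01 : 0 <= (set_val x : R) <= 1 by have := set_valP x; rewrite /= in_itv.
have yP (y : R) : 0 <= y <= 1 -> y \in `[0 : R, 1]%classic.
  by move=> y01; rewrite inE /= in_itv.
pose d := Num.min (e / 2) (1 / 2).
have [d0 de d12] : [/\ 0 < d, d < e & d <= 1 / 2].
  rewrite lt_min gt_min ge_min lexx orbT; split=> //.
    by rewrite !divr_gt0.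
  by apply/orP; left; rewrite ltr_pdivrMr // ltr_pMr // ltr1n.
have [z [z01 zx ez]] : exists z : R,
    [/\ 0 <= z <= 1, z != set_val x & `|set_val x - z| < e].
  exists (if set_val x <= 1 / 2 then set_val x + d else set_val x - d).
  split; first by case: ifPn; move: x01; lra.
    by case: ifPn => _; apply/eqP; lra.
  case: ifPn => _; first by rewrite opprD addNKr normrN gtr0_norm.
  by rewrite opprB addrC subrK gtr0_norm.
exists (exist _ z (yP z z01)); apply: BA; first exact: eB.
by apply: contra_neq zx => <-.
Qed.
#[local] Existing Instance I_dnbhs_proper.

Lemma diff_quotP (a : R[i]) f g x :
  diff_quot (a *: f + g) x = a *: diff_quot f x + diff_quot g x.
Proof.
apply/funext => y; rewrite /diff_quot !fctE /= /GRing.scale /=.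
rewrite opprD addrACA -mulrBr mulrDr; congr (_ + _).
by rewrite mulrCA.
Qed.

Lemma I_derivableP (a : R[i]) f g x : I_derivable f x -> I_derivable g x ->
  I_derivable (a *: f + g) x.
Proof.
move=> df dg; rewrite /I_derivable diff_quotP.
have Zdf := @is_cvgZr _ R[i]^o _ x^' (dnbhs_filter x) a _ df.
exact: (@is_cvgD _ R[i]^o _ x^' (dnbhs_filter x) _ _ Zdf dg).
Qed.

Lemma I_deriveP (a : R[i]) f g x : I_derivable f x -> I_derivable g x ->
  I_derive (a *: f + g) x = a *: I_derive f x + I_derive g x.
Proof.
move=> df dg; rewrite /I_derive diff_quotP.
have Zdf := @is_cvgZr _ R[i]^o _ x^' (dnbhs_filter x) a _ df.
rewrite (@limD _ R[i]^o _ x^' _ _ _ Zdf dg).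
by rewrite (@limZr _ R[i]^o _ x^' _ a _ df).
Qed.

Lemma I_derive_nP (a : R[i]) f g n : I_smooth f -> I_smooth g ->
  I_derive_n n (a *: f + g) = a *: I_derive_n n f + I_derive_n n g.
Proof.
move=> sf sg; elim: n => [//|n IHn]; rewrite /I_derive_n !iterS.
rewrite -/(I_derive_n n _) IHn; apply/funext => x.
by rewrite I_deriveP.
Qed.

Lemma I_smoothP (a : R[i]) f g : I_smooth f -> I_smooth g ->
  I_smooth (a *: f + g).
Proof.
move=> sf sg n x; rewrite I_derive_nP //.
by apply: I_derivableP; [exact: sf|exact: sg].
Qed.

Lemma diff_quot0 x : diff_quot (0 : I -> R[i]^o) x = fun=> 0.
Proof.
apply/funext => y; rewrite /diff_quot.
by rewrite -[X in _ * X]/(0 - 0 : R[i]) subrr mulr0.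
Qed.

Lemma I_derive0 : I_derive (0 : I -> R[i]^o) = 0.
Proof.
apply/funext => x; rewrite /I_derive.
rewrite diff_quot0.
exact: (lim_cst (@norm_hausdorff _ R[i]^o)).
Qed.

Lemma I_derive_n0 n : I_derive_n n (0 : I -> R[i]^o) = 0.
Proof.
by elim: n => [//|n IHn]; rewrite /I_derive_n iterS -/(I_derive_n n _) IHn I_derive0.
Qed.

Lemma I_smooth0 : I_smooth (0 : I -> R[i]^o).
Proof.
move=> n x; rewrite I_derive_n0 /I_derivable.
rewrite diff_quot0.
exact: is_cvg_cst.
Qed.

Lemma sup_norm_ub f x : ((normc (f x))%:E <= sup_norm f)%E.
Proof. by apply: ereal_sup_ubound; exists x. Qed.

Lemma normc_ge0 (z : R[i]) : 0 <= normc z.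
Proof. by case: z => a b; exact: sqrtr_ge0. Qed.

Lemma sup_norm_ge0 f : (0 <= sup_norm f)%E.
Proof.
apply: (le_trans _ (sup_norm_ub f point)).
by rewrite lee_fin normc_ge0.
Qed.

Lemma sup_norm0 : sup_norm (0 : I -> R[i]^o) = 0%E.
Proof.
apply/eqP; rewrite eq_le sup_norm_ge0 andbT.
by apply: ge_ereal_sup => _ [x _ <-]; rewrite normc0.
Qed.

Lemma sup_normD f g : (sup_norm (f + g)%R <= sup_norm f + sup_norm g)%E.
Proof.
apply: ge_ereal_sup => _ [x _ <-].
apply: (le_trans _ (leeD (sup_norm_ub f x) (sup_norm_ub g x))).
rewrite lee_fin -lecR rmorphD/=.
exact: (@ler_normD _ R[i]).
Qed.

Lemma sup_normZ (a : R[i]) f :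
  sup_norm (a *: f) = ((normc a)%:E * sup_norm f)%E.
Proof.
rewrite /sup_norm -ereal_supZl ?normc_ge0 //; last first.
  by apply/set0P; exists (normc (f point))%:E; exists point.
congr ereal_sup; apply/seteqP; split.
  move=> _ [x _ <-]; exists (normc (f x))%:E; first by exists x.
  by rewrite -EFinM -normcM.
move=> _ [_ [x _ <-] <-]; exists x => //.
by rewrite -EFinM -normcM.
Qed.

End derivative_theory.

Section D_space.
Variables (R : realType) (M : weight_sequence R).
Local Notation I := (unit_interval R).
Implicit Types f g : I -> R[i]^o.

Definition D_norm f : \bar R :=
  (\sum_(0 <= n <oo) (sup_norm (I_derive_n n f) * (M n)^-1%:E))%E.

Definition in_D : {pred (I -> R[i]^o)} :=
  fun f => `[< I_smooth f /\ (D_norm f < +oo)%E >].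

Lemma D_term_ge0 f n : (0 <= sup_norm (I_derive_n n f) * (M n)^-1%:E)%E.
Proof.
by rewrite mule_ge0 ?sup_norm_ge0 // lee_fin invr_ge0 ltW // weight_gt0.
Qed.

Lemma D_norm_ge0 f : (0 <= D_norm f)%E.
Proof. by apply: nneseries_ge0 => n _ _; exact: D_term_ge0. Qed.

Lemma D_normP (a : R[i]) f g : I_smooth f -> I_smooth g ->
  (D_norm (a *: f + g)%R <= (normc a)%:E * D_norm f + D_norm g)%E.
Proof.
move=> sf sg; rewrite /D_norm -nneseriesZl; last by move=> *; exact: D_term_ge0.
rewrite -nneseriesD; first last.
- by move=> *; exact: D_term_ge0.
- by move=> *; rewrite mule_ge0 ?D_term_ge0 // lee_fin normc_ge0.
apply: lee_nneseries => n _; first by move=> _; exact: D_term_ge0.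
rewrite I_derive_nP // muleA -ge0_muleDl ?sup_norm_ge0 //; last first.
  by rewrite mule_ge0 ?sup_norm_ge0 // lee_fin normc_ge0.
apply: lee_wpmul2r; first by rewrite lee_fin invr_ge0 ltW // weight_gt0.
by rewrite -sup_normZ sup_normD.
Qed.

Lemma in_D_submod_closed : submod_closed in_D.
Proof.
split=> [|a f g].
  apply/asboolP; split; first exact: I_smooth0.
  rewrite /D_norm (eq_eseriesr (g := fun=> 0%E)) ?eseries0 // => n _.
  by rewrite I_derive_n0 sup_norm0 mul0e.
move=> /asboolP[sf Df] /asboolP[sg Dg]; apply/asboolP; split.
  exact: I_smoothP.
apply: (le_lt_trans (D_normP _ sf sg)); rewrite lte_add_pinfty //.
by rewrite lte_mul_pinfty // lee_fin normc_ge0.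
Qed.

HB.instance Definition _ :=
  GRing.isSubmodClosed.Build _ _ in_D in_D_submod_closed.

Record Dspace : Type := MkDspace {
  D_fun :> I -> R[i]^o ;
  D_funP : D_fun \in in_D }.

HB.instance Definition _ := [isSub for D_fun].
HB.instance Definition _ := [Choice of Dspace by <:].
HB.instance Definition _ := [SubChoice_isSubLmodule of Dspace by <:].

Lemma D_norm_fin_num (f : Dspace) : D_norm f \is a fin_num.
Proof.
by have /asboolP[_ Df] := D_funP f; rewrite ge0_fin_numE // D_norm_ge0.
Qed.

(* A norm on a module over [R[i]] takes its values in [R[i]]. *)
Definition Dspace_norm (f : Dspace) : R[i] := (fine (D_norm f))%:C.

Lemma D_normZ (a : R[i]) f : I_smooth f ->
  D_norm (a *: f) = ((normc a)%:E * D_norm f)%E.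
Proof.
move=> sf; rewrite /D_norm -nneseriesZl; last by move=> *; exact: D_term_ge0.
apply: eq_eseriesr => n _; rewrite muleA -sup_normZ; congr (sup_norm _ * _)%E.
have := I_derive_nP a n sf (@I_smooth0 R).
by rewrite I_derive_n0 !addr0.
Qed.

Lemma Dspace_normD (f g : Dspace) :
  Dspace_norm (f + g) <= Dspace_norm f + Dspace_norm g.
Proof.
have /asboolP[sf _] := D_funP f; have /asboolP[sg _] := D_funP g.
rewrite /Dspace_norm -rmorphD/= lecR.
have Dfg : (D_norm (f + g)%R <= D_norm f + D_norm g)%E.
  by have := D_normP 1 sf sg; rewrite scale1r normc1 mul1e; exact.
rewrite -(fineD (D_norm_fin_num f) (D_norm_fin_num g)).
apply: (fine_le (D_norm_fin_num (f + g)) _ Dfg).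
by rewrite fin_numD (D_norm_fin_num f) (D_norm_fin_num g).
Qed.

Lemma Dspace_normZ (a : R[i]) (f : Dspace) :
  Dspace_norm (a *: f) = `|a| * Dspace_norm f.
Proof.
have /asboolP[sf _] := D_funP f.
rewrite /Dspace_norm [X in D_norm X]/= D_normZ // fineM ?D_norm_fin_num //.
by rewrite rmorphM.
Qed.

Lemma Dspace_norm0_eq0 (f : Dspace) : Dspace_norm f = 0 -> f = 0.
Proof.
move=> [/eqP]; rewrite fine_eq0 ?D_norm_fin_num // => /eqP f0.
apply: val_inj; apply/funext => x /=; apply: eq0_normc.
have : (sup_norm f * (M 0%N)^-1%:E <= 0)%E.
  rewrite -f0 /D_norm nneseries_recl // => [|n _]; last exact: D_term_ge0.
  by rewrite leeDl // nneseries_ge0 // => n _ _; exact: D_term_ge0.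
rewrite weight0 invr1 mule1 => /(le_trans (sup_norm_ub f x)).
by rewrite lee_fin => fx0; apply/eqP; rewrite eq_le fx0 normc_ge0.
Qed.

HB.instance Definition _ := @Lmodule_isNormed.Build R[i] Dspace
  Dspace_norm Dspace_normD Dspace_normZ Dspace_norm0_eq0.

Section composition.
Variable phi : I -> I.

Definition induces_endomorphism : Prop :=
  forall f, f \in in_D -> f \o phi \in in_D.

Variable phiD : induces_endomorphism.

Definition comp_endo (f : Dspace) : Dspace := MkDspace (phiD (D_funP f)).

Lemma comp_endo_linear : linear comp_endo.
Proof. by move=> a f g; apply: val_inj. Qed.

HB.instance Definition _ := GRing.isLinear.Build R[i] Dspace Dspace *:%R
  comp_endo comp_endo_linear.

End composition.

End D_space.

(* Main.v *)
(* Let [q] be fixed by [psi], let [c] be the derivative of [psi] at [q], and let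
   [V_n] be the space of functions of D that are O((x - q)^n). Composition with
   [psi] preserves every [V_n] and acts as [c ^+ n] on the line [V_n / V_(n+1)],
   so a Riesz argument along this chain shows that [|c| < 1] when composition
   with [psi] is compact. This applies to [phi] at its fixed points and, since
   T^2 is compact too, to [phi \o phi] at its own.

   Fix [x0] with [phi x0 = x0] and let [c] be the derivative of [phi] there. An
   eigenfunction for [lambda] in [V_n] but not in [V_(n+1)] forces
   [lambda = c ^+ n], which determines [n]. Hence some linear combination of two
   eigenfunctions is flat at [x0], and it suffices that a flat eigenfunction [f]
   is zero. It vanishes near [x0] because [phi] contracts there. Were the
   component of [x0] in its zero set not all of [0, 1], [phi] would map the at
   most two boundary points of this component to each other or to themselves, so
   that one of them would be fixed by [phi \o phi]; but [f] is flat there as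
   well, hence zero near that point, a contradiction. *)

Require Import Defs.
From HB Require Import structures.
From mathcomp Require Import all_boot all_order all_algebra.
From mathcomp Require Import all_classical all_reals all_analysis.
From mathcomp Require Import complex.
From mathcomp Require Import ring lra.

Set Implicit Arguments.
Unset Strict Implicit.
Unset Printing Implicit Defensive.

Import Order.TTheory GRing.Theory Num.Theory numFieldNormedType.Exports.
Import Normc.

Local Open Scope classical_set_scope.
Local Open Scope ring_scope.
Local Open Scope complex_scope.

(** * One-sided derivatives on [0, 1] and polynomials as elements of D *)

Section Derivatives.
Variable R : realType.
Local Notation I := (unit_interval R).
Implicit Types (f g : I -> R[i]^o) (x y q : I) (z w : R[i]) (p : {poly R[i]}).

Lemma normcD z w : normc (z + w) <= normc z + normc w.
Proof. exact: le_normcD. Qed.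

Lemma normc_opp z : normc (- z) = normc z.
Proof. exact: normcN. Qed.

Lemma normcB z w : normc (z - w) = normc (w - z).
Proof. by rewrite -normc_opp opprB. Qed.

Lemma normcX z n : normc (z ^+ n) = normc z ^+ n.
Proof. by elim: n => [|n IH]; rewrite ?expr0 ?normc1 // !exprS normcM IH. Qed.

Lemma normc_real (r : R) : normc r%:C = `|r|.
Proof. by rewrite /normc /= expr0n /= addr0 sqrtr_sqr. Qed.

Lemma normrcE z : `|z| = real_complex R (normc z).
Proof. by []. Qed.

Lemma normc_gt0 z : (0 < normc z) = (z != 0).
Proof.
rewrite lt_neqAle normc_ge0 andbT eq_sym; congr (~~ _).
by apply/eqP/eqP => [/eq0_normc //|->]; rewrite normc0.
Qed.

Lemma nbhs_IP x (P : set I) :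
  nbhs x P <-> exists2 e : R, 0 < e & forall y, `|set_val x - set_val y| < e -> P y.
Proof.
split=> [/nbhs_ballP[e e0 H]|[e e0 H]]; first by exists e.
by apply/nbhs_ballP; exists e.
Qed.

(** Differentiability through the first-order error term: free of division and of the punctured
    neighbourhood, hence suited to explicit estimates. *)
Definition has_deriv f x (l : R[i]^o) := forall e : R, 0 < e ->
  exists2 d : R, 0 < d & forall y, `|set_val x - set_val y| < d ->
    normc (f y - f x - l * (set_val y - set_val x)%:C)
      <= e * `|set_val x - set_val y|.

Lemma diff_quotE f x y (l : R[i]^o) : y != x ->
  normc (f y - f x - l * (set_val y - set_val x)%:C) =
  normc (l - diff_quot f x y) * `|set_val x - set_val y|.
Proof.
move=> yx; rewrite distrC -normc_real -normcM normcB; congr normc.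
have d0 : (set_val y - set_val x)%:C != 0 :> R[i].
  rewrite fmorph_eq0 subr_eq0; apply: contra_neq yx => yx.
  exact: val_inj.
by rewrite /diff_quot mulrBl mulrAC mulVf // mul1r.
Qed.

Lemma has_derivP f x (l : R[i]^o) :
  diff_quot f x y @[y --> x^'] --> l <-> has_deriv f x l.
Proof.
split=> [fl e e0|fl].
  have e0' : 0 < e%:C :> R[i] by rewrite ltcR.
  have FF := I_dnbhs_proper x.
  have /cvgrPdist_le/(_ _ e0') := fl.
  rewrite /dnbhs near_withinE => /nbhs_IP[d d0 H]; exists d => // y xy.
  have [->|yx] := eqVneq y x.
    by rewrite !subrr mulr0 subrr normc0 normr0 mulr0.
  rewrite diff_quotE // ler_wpM2r //.
  by have := H y xy yx; rewrite normrcE lecR.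
have FF := I_dnbhs_proper x.
apply/cvgrPdist_le => -[e e'] /[!ltcE]/= /andP[/eqP -> e0].
have [d d0 H] := fl _ e0.
rewrite /dnbhs near_withinE; apply/nbhs_IP; exists d => // y xy yx.
have := H y xy; rewrite diff_quotE // ler_pM2r => [|]; last first.
  rewrite normr_gt0 subr_eq0; apply: contra_neq yx => yx.
  by apply: val_inj.
by rewrite normrcE lecR.
Qed.

Lemma I_deriveE f x (l : R[i]^o) : has_deriv f x l ->
  I_derivable f x /\ I_derive f x = l.
Proof.
have FF := I_dnbhs_proper x.
move=> /has_derivP fl; split; first by apply/cvg_ex; exists l.
by apply: cvg_lim fl; exact: (@norm_hausdorff _ R[i]^o).
Qed.

Lemma I_derivable_has f x : I_derivable f x -> has_deriv f x (I_derive f x).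
Proof. by move=> fx; apply/has_derivP. Qed.

Lemma I_accumulation q (e : R) : 0 < e ->
  exists2 x, x != q & `|set_val q - set_val x| < e.
Proof.
move=> e0; have FF := I_dnbhs_proper q.
have : \forall x \near q^', x != q /\ `|set_val q - set_val x| < e.
  by rewrite /dnbhs near_withinE; apply/nbhs_IP; exists e.
by move=> /filter_ex[x []]; exists x.
Qed.

Lemma I_dist_gt0 x y : (0 < `|set_val x - set_val y|) = (y != x).
Proof.
rewrite normr_gt0 subr_eq0; congr (~~ _).
by apply/eqP/eqP => [xy|->//]; apply/esym/val_inj.
Qed.

Lemma I_le1 x : 0 <= (set_val x : R) <= 1.
Proof. by have := set_valP x; rewrite /= in_itv. Qed.

Lemma I_dist_le1 x y : `|set_val x - set_val y| <= 1 :> R.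
Proof.
by have := I_le1 x; have := I_le1 y; rewrite ler_norml; lra.
Qed.

Definition poly_fun p : I -> R[i]^o := fun x => p.[(set_val x)%:C].

Lemma has_deriv_poly p x : has_deriv (poly_fun p) x (p^`()).[(set_val x)%:C].
Proof.
elim/poly_ind: p => [|p c IH] e e0.
  exists 1 => // y _; rewrite /poly_fun deriv0 !horner0 mul0r !subr0 normc0.
  by rewrite mulr_ge0 // ltW.
rewrite /poly_fun derivD derivC addr0 derivM derivX mulr1 hornerE.
set l := (p^`()).[(set_val x)%:C].
have [d d0 H] := IH _ (divr_gt0 e0 (ltr0n R 2)).
have N0 : 0 < 2 * (normc l + 1).
  by rewrite mulr_gt0 // ltr_wpDl // normc_ge0.
exists (Num.min d (e / (2 * (normc l + 1)))).
  by rewrite lt_min d0 divr_gt0.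
move=> y; rewrite lt_min => /andP[/H{}H ye]; rewrite !hornerE.
set X := (set_val x)%:C; set Y := (set_val y)%:C.
have -> : p.[Y] * Y + c - (p.[X] * X + c) - (l * X + p.[X]) * (set_val y - set_val x)%:C
   = (p.[Y] - p.[X] - l * (set_val y - set_val x)%:C) * Y
     + l * (set_val y - set_val x)%:C * (set_val y - set_val x)%:C.
  by rewrite !rmorphB /= -/X -/Y; ring.
apply: (le_trans (normcD _ _)); rewrite !normcM !normc_real.
rewrite [`|set_val y - _|]distrC; rewrite /poly_fun -/X -/Y -/l in H.
have y1 : `|set_val y| <= 1 :> R by rewrite ler_norml; have := I_le1 y; lra.
rewrite [e in X in _ <= X]splitr mulrDl; apply: lerD.
  by rewrite -[leRHS]mulr1; apply: ler_pM => //; exact: normc_ge0.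
rewrite ler_wpM2r //; move: ye; rewrite ltr_pdivlMr // => ye.
have := normc_ge0 l; have := normr_ge0 (set_val y - set_val x : R).
by move: ye; nra.
Qed.

Lemma I_derive_poly p : I_derive (poly_fun p) = poly_fun p^`().
Proof. by apply/funext => x; have [_] := I_deriveE (has_deriv_poly p x). Qed.

Lemma I_derive_n_poly n p : I_derive_n n (poly_fun p) = poly_fun p^`(n).
Proof.
elim: n => [|n IH]; first by rewrite derivn0.
by rewrite /I_derive_n iterS -/(I_derive_n n _) IH I_derive_poly -derivnS.
Qed.

Lemma poly_fun_smooth p : I_smooth (poly_fun p).
Proof.
move=> n x; rewrite I_derive_n_poly.
by have [] := I_deriveE (has_deriv_poly p^`(n) x).
Qed.

Lemma sup_norm_poly p : (sup_norm (poly_fun p) < +oo)%E.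
Proof.
have [B HB] : exists B : R, forall x, normc (poly_fun p x) <= B.
  elim/poly_ind: p => [|p c [B IH]].
    by exists 0 => x; rewrite /poly_fun horner0 normc0.
  exists (B + normc c) => x; rewrite /poly_fun !hornerE.
  apply: (le_trans (normcD _ _)); rewrite lerD2r normcM.
  rewrite -[leRHS]mulr1; apply: ler_pM; rewrite ?normc_ge0 ?IH //.
  by rewrite normc_real ler_norml; have := I_le1 x; lra.
apply: (@le_lt_trans _ _ B%:E); last exact: ltry.
by apply: ge_ereal_sup => _ [x _ <-]; rewrite lee_fin.
Qed.

(** The derivatives of order at least [size p] vanish, so the series is a finite sum, and each of
    its terms is finite because polynomials are bounded on [0, 1]. *)
Lemma poly_fun_in_D (M : weight_sequence R) p : poly_fun p \in in_D M.
Proof.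
apply/asboolP; split; first exact: poly_fun_smooth.
rewrite /D_norm (@nneseries_split _ _ 0%N (size p)); last first.
  by move=> k _; exact: D_term_ge0.
rewrite [X in (_ + X)%E]eseries0 ?adde0; last first.
  move=> k /= kp _; rewrite I_derive_n_poly.
  rewrite (_ : p^`(k) = 0); last first.
    apply/polyP => i; rewrite coef_derivn coef0 nth_default ?mul0rn //.
    by rewrite (leq_trans kp) // leq_addr.
  rewrite (_ : poly_fun 0 = 0) ?sup_norm0 ?mul0e //.
  by apply/funext => x; rewrite /poly_fun horner0.
apply: lte_sum_pinfty => k _; rewrite I_derive_n_poly lte_mul_pinfty //.
- exact: sup_norm_ge0.
- by rewrite ge0_fin_numE ?sup_norm_ge0 // sup_norm_poly.
- exact: ltry.
Qed.

End Derivatives.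

(** * Mean value inequalities for complex-valued functions *)

Section MeanValue.
Variable R : realType.
Local Notation I := (unit_interval R).
Implicit Types (f g : I -> R[i]^o) (x y q : I).

Lemma clamp_subproof (t : R) : Num.max 0 (Num.min t 1) \in `[0 : R, 1]%classic.
Proof. by rewrite inE /= in_itv /= le_max lexx ge_max ler01 ge_min lexx orbT. Qed.

(** A 1-Lipschitz retraction of the line onto [0, 1]. Precomposing with it brings the mean value
    theorem, the intermediate value theorem and connectedness from the line to the subtype. *)
Definition clamp (t : R) : I := exist _ (Num.max 0 (Num.min t 1)) (clamp_subproof t).

Lemma val_clamp (t : R) : set_val (clamp t) = Num.max 0 (Num.min t 1).
Proof. by []. Qed.

Lemma clampE (t : R) : 0 <= t <= 1 -> set_val (clamp t) = t.
Proof. by move=> /andP[t0 t1]; rewrite val_clamp min_l // max_r. Qed.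

Lemma clampK x : clamp (set_val x) = x.
Proof. by apply: val_inj; apply: clampE; exact: I_le1. Qed.

Lemma clamp_dist (s t : R) :
  `|set_val (clamp s) - set_val (clamp t)| <= `|s - t|.
Proof.
have H (a b : R) : a <= b -> `|set_val (clamp b) - set_val (clamp a)| <= b - a.
  move=> ab; rewrite !val_clamp ler_norml.
  by rewrite /Num.max /Num.min; do !case: ifPn; lra.
have [st|/ltW ts] := leP s t.
  by rewrite distrC [leRHS]distrC [leRHS]ger0_norm ?subr_ge0 // H.
by rewrite [leRHS]ger0_norm ?subr_ge0 // H.
Qed.

Lemma clamp_continuous (v : I -> R) :
    (forall x (e : R), 0 < e -> exists2 d : R, 0 < d &
      forall y, `|set_val x - set_val y| < d -> `|v x - v y| <= e) ->
  continuous (v \o clamp).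
Proof.
move=> vC t; apply/cvgrPdist_le => e e0.
have [d d0 H] := vC (clamp t) _ e0.
near=> s; apply: H; apply: (le_lt_trans (clamp_dist _ _)).
by near: s; exact: cvgr_dist_lt.
Unshelve. all: by end_near. Qed.

Lemma I_MVT (v v' : I -> R) :
    (forall x (e : R), 0 < e -> exists2 d : R, 0 < d &
      forall y, `|set_val x - set_val y| < d ->
      `|v y - v x - v' x * (set_val y - set_val x)|
        <= e * `|set_val x - set_val y|) ->
  forall x y, set_val x < set_val y -> exists2 z,
    set_val x < set_val z < set_val y &
    v y - v x = v' z * (set_val y - set_val x).
Proof.
move=> vD x y xy.
have := I_le1 x; have := I_le1 y => y1 x1.
have vC : continuous (v \o clamp).
  apply: clamp_continuous => z e e0; have [d d0 H] := vD z _ ltr01.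
  have N0 : 0 < `|v' z| + 1 by rewrite ltr_wpDl.
  exists (Num.min d (e / (`|v' z| + 1))); first by rewrite lt_min d0 divr_gt0.
  move=> s; rewrite lt_min => /andP[/H{}H]; rewrite ltr_pdivlMr // => ze.
  rewrite distrC -[v s - v z](subrK (v' z * (set_val s - set_val z))).
  apply: (le_trans (ler_normD _ _)); rewrite normrM [`|set_val s - _|]distrC.
  by rewrite mul1r in H; move: ze H; lra.
have vder t : t \in `](set_val x : R), set_val y[ ->
    is_derive t 1 (v \o clamp) (v' (clamp t)).
  rewrite in_itv /= => /andP[xt ty].
  have ct : set_val (clamp t) = t by apply: clampE; lra.
  have H : h^-1 *: ((v \o clamp) (h *: (1 : R) + t) - (v \o clamp) t)
       @[h --> (0 : R)^'] --> v' (clamp t).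
    apply/cvgrPdist_le => e e0.
    have [d d0 {}H] := vD (clamp t) _ e0.
    (* The bounds by [t] and [1 - t] keep [h + t] inside [0, 1], where [clamp] is the identity. *)
    have m0 : 0 < Num.min d (Num.min t (1 - t)) by rewrite !lt_min; lra.
    near=> h.
    have h0 : h != 0 by near: h; exact: nbhs_dnbhs_neq.
    have [th htd] : 0 <= h + t <= 1 /\ `|h| < d.
      have : `|h| < Num.min d (Num.min t (1 - t)).
        by near: h; apply: dnbhs0_lt.
      rewrite !lt_min => /and3P[-> + +]; rewrite !ltr_norml.
      by move=> /andP[? ?] /andP[? ?]; split; lra.
    have := H (clamp (h + t)); rewrite ct (clampE th).
    rewrite (_ : t - (h + t) = - h) ?normrN; last by ring.
    rewrite addrK => /(_ htd) {}H.
    rewrite /= /GRing.scale /= mulr1 -(ler_pM2r (_ : 0 < `|h|)) ?normr_gt0 //.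
    by rewrite -normrM mulrBl mulrAC mulVf // mul1r distrC.
  by split; [apply/cvg_ex; exists (v' (clamp t))|exact: cvg_lim H].
have [z] := MVT xy vder (continuous_subspaceT vC).
rewrite in_itv /= !clampK => /andP[xz zy] E; exists (clamp z) => //.
by rewrite clampE ?xz //; lra.
Unshelve. all: by end_near. Qed.

(** The mean value theorem fails for complex values, so it is applied to the real part of [w * g],
    with [w] the conjugate of [g x]: this function grows from 0 at [q] to |g x|^2 at [x]. *)
Lemma mean_value_normc g g' q x (K : R) :
    (forall y, has_deriv g y (g' y)) -> g q = 0 ->
    (forall y, `|set_val q - set_val y| <= `|set_val q - set_val x| ->
      normc (g' y) <= K) ->
  normc (g x) <= K * `|set_val q - set_val x|.
Proof.
move=> gD gq g'K.
have K0 : 0 <= K by apply: le_trans (g'K x _) => //; exact: normc_ge0.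
have [gx0|gx0] := eqVneq (g x) 0; first by rewrite gx0 normc0 mulr_ge0.
have {}gx0 : 0 < normc (g x) by rewrite normc_gt0.
have [w wE nw] : exists2 w, w = conjc (g x) & normc w = normc (g x).
  by exists (conjc (g x)) => //; case: (g x) => a b /=; rewrite sqrrN.
pose v y := complex.Re (w * g y).
pose v' y := complex.Re (w * g' y).
have vD y (e : R) : 0 < e -> exists2 d : R, 0 < d &
    forall z, `|set_val y - set_val z| < d ->
    `|v z - v y - v' y * (set_val z - set_val y)|
      <= e * `|set_val y - set_val z|.
  move=> e0; have [d d0 H] := gD y _ (divr_gt0 e0 gx0).
  exists d => // z /H{}H.
  have -> : v z - v y - v' y * (set_val z - set_val y) =
      complex.Re (w * (g z - g y - g' y * (set_val z - set_val y)%:C)).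
    rewrite /v /v'.
    move: (g z) (g y) (g' y) w {wE nw v v'} => [a b] [c d'] [a' b'] [s t] /=.
    by ring.
  rewrite -lecR; apply: (le_trans (normc_ge_Re _)).
  rewrite normrcE lecR normcM nw.
  by rewrite -ler_pdivlMl // mulrA [_^-1 * e]mulrC.
have main z : `|set_val q - set_val z| <= `|set_val q - set_val x| ->
    v x - v q = v' z * (set_val x - set_val q) ->
    normc (g x) <= K * `|set_val q - set_val x|.
  move=> qz E; rewrite -(ler_pM2l gx0).
  have -> : normc (g x) * normc (g x) = v x - v q.
    rewrite /v gq mulr0 subr0 -expr2 wE; case: (g x) => a b /=.
    by rewrite sqr_sqrtr ?addr_ge0 ?sqr_ge0 //; ring.
  rewrite E; apply: (le_trans (ler_norm _)); rewrite normrM distrC mulrA.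
  rewrite ler_wpM2r // -lecR; apply: (le_trans (normc_ge_Re _)).
  by rewrite normrcE lecR normcM nw ler_wpM2l ?normc_ge0 // g'K.
have [qx|xq|qx] := ltgtP (set_val q : R) (set_val x).
- have [z /andP[qz zx] E] := I_MVT vD qx; apply: main E.
  by rewrite !ler0_norm; lra.
- have [z /andP[qz zx] E] := I_MVT vD xq; apply: (main z).
    by rewrite !ger0_norm; lra.
  by rewrite -opprB E; ring.
- by move: gx0; rewrite -(val_inj qx) gq normc0 ltxx.
Qed.

Lemma mean_value_pow g g' q (C : R) n :
    (forall y, has_deriv g y (g' y)) -> g q = 0 ->
    (forall y, normc (g' y) <= C * `|set_val q - set_val y| ^+ n) ->
  forall x, normc (g x) <= C * `|set_val q - set_val x| ^+ n.+1.
Proof.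
move=> gD gq gC x; rewrite exprSr mulrA.
apply: (mean_value_normc gD) => // y yx; apply: (le_trans (gC y)).
(* Monotonicity of the power needs [0 <= C]. The bound at [y] yields this if [y != q]; at [q] the
   power may be 0, and another point has to be used. *)
have [->|yq] := eqVneq y q; last first.
  have C0 : 0 <= C.
    have := le_trans (normc_ge0 _) (gC y).
    by rewrite pmulr_lge0 // exprn_gt0 // I_dist_gt0.
  by rewrite ler_wpM2l // lerXn2r.
have C0 : 0 <= C.
  have [z zq _] := I_accumulation q (@ltr01 R).
  have := le_trans (normc_ge0 _) (gC z).
  by rewrite pmulr_lge0 // exprn_gt0 // I_dist_gt0.
by rewrite ler_wpM2l // lerXn2r //= ?nnegrE ?subrr ?normr0.
Qed.

End MeanValue.

(** * Taylor expansion and order of vanishing *)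

Section Taylor.
Variable R : realType.
Local Notation I := (unit_interval R).
Implicit Types (f g : I -> R[i]^o) (x y q : I).

Definition shift q x : R[i] := (set_val x - set_val q)%:C.

Lemma normc_shift q x : normc (shift q x) = `|set_val q - set_val x|.
Proof. by rewrite normc_real distrC. Qed.

Lemma normc_shift_le1 q x : normc (shift q x) <= 1.
Proof. by rewrite normc_shift I_dist_le1. Qed.

Lemma normc_shift_gt0 q x : (0 < normc (shift q x)) = (x != q).
Proof. by rewrite normc_shift I_dist_gt0. Qed.

(** The functions of D with this property form the space V_n. The constant is global, so no
    neighbourhood of [q] has to be carried along. *)
Definition vanish n q (f : I -> R[i]) : Prop :=
  exists C : R, forall x, normc (f x) <= C * normc (shift q x) ^+ n.

Lemma vanish_shift n q : vanish n q (fun x => shift q x ^+ n).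
Proof. by exists 1 => x; rewrite normcX mul1r. Qed.

Lemma vanishP n q (a b : R[i]) f g : vanish n q f -> vanish n q g ->
  vanish n q (fun x => a * f x + b * g x).
Proof.
move=> [C fC] [D gD]; exists (normc a * C + normc b * D) => x.
apply: (le_trans (normcD _ _)); rewrite !normcM mulrDl -!mulrA.
by apply: lerD; rewrite ler_wpM2l ?normc_ge0.
Qed.

Lemma vanish_ge0 n q f : vanish n q f ->
  exists2 C : R, 0 <= C & forall x, normc (f x) <= C * normc (shift q x) ^+ n.
Proof.
move=> [C fC]; exists `|C| => // x; apply: (le_trans (fC x)).
by rewrite ler_wpM2r ?exprn_ge0 ?normc_ge0 // ler_norm.
Qed.

Lemma vanish_le m n q f : (m <= n)%N -> vanish n q f -> vanish m q f.
Proof.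
move=> mn /vanish_ge0[C C0 fC]; exists C => x; apply: (le_trans (fC x)).
rewrite ler_wpM2l // -(subnK mn) exprD ler_piMl ?exprn_ge0 ?normc_ge0 //.
by rewrite exprn_ile1 ?normc_ge0 ?normc_shift_le1.
Qed.

(** Letting x tend to [q] along the given points kills [a 0]; dividing by the shift then lowers the
    degree. Requiring the bound only at points arbitrarily close to [q] lets the lemma serve both
    for functions in V_n and for functions with accumulating zeros. *)
Lemma poly_coef_eq0 n q (a : nat -> R[i]) (C : R) :
    (forall e : R, 0 < e -> exists2 x, 0 < normc (shift q x) < e &
      normc (\sum_(k < n) a k * shift q x ^+ k) <= C * normc (shift q x) ^+ n) ->
  forall k, (k < n)%N -> a k = 0.
Proof.
elim: n a => [//|n IH] a aC.
have sumE x : \sum_(k < n.+1) a k * shift q x ^+ k =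
    a 0%N + shift q x * \sum_(k < n) a k.+1 * shift q x ^+ k.
  rewrite big_ord_recl expr0 mulr1; congr (_ + _); rewrite mulr_sumr.
  by apply: eq_bigr => i _; rewrite mulrCA -exprS.
have a0 : a 0%N = 0.
  apply/eqP/negP => /negP; rewrite -normc_gt0 => a0.
  pose B := \sum_(k < n) normc (a k.+1).
  have B0 : 0 <= B by apply: sumr_ge0 => i _; exact: normc_ge0.
  have N0 : 0 < B + `|C| + 1 by rewrite ltr_wpDl // addr_ge0.
  have [x /andP[x0 xe]] := aC _ (divr_gt0 a0 N0).
  rewrite sumE; set Q := \sum_(k < n) _ => xC.
  have QB : normc Q <= B.
    rewrite /Q /B; elim/big_ind2: _ => [|u v w z uv wz|i _].
    - by rewrite normc0.
    - by apply: (le_trans (normcD _ _)); exact: lerD.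
    - rewrite normcM ler_piMr ?normc_ge0 // normcX.
      by rewrite exprn_ile1 ?normc_ge0 ?normc_shift_le1.
  move: xe; rewrite ltr_pdivlMr // ltNge => /negP; apply.
  rewrite -[a 0%N](addrK (shift q x * Q)).
  apply: (le_trans (normcD _ _)); rewrite normc_opp normcM.
  have h1 := normc_shift_le1 q x.
  have : C * normc (shift q x) ^+ n.+1 <= `|C| * normc (shift q x).
    rewrite exprS mulrCA mulrC ler_wpM2r ?normc_ge0 //.
    apply: (le_trans (ler_norm _)); rewrite normrM ler_piMr //.
    by rewrite ger0_norm ?exprn_ge0 ?exprn_ile1 ?normc_ge0.
  by move: xC x0 QB N0; nra.
move=> [//|k]; rewrite ltnS; apply: (IH (fun k => a k.+1)) => e e0.
have [x /andP[x0 xe] xC] := aC e e0; exists x; first by rewrite x0.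
move: xC; rewrite sumE a0 add0r normcM exprS mulrCA.
by rewrite ler_pM2l.
Qed.

Definition tcoef f q k : R[i] := I_derive_n k f q / k`!%:R.

Definition taylor f q n : {poly R[i]} :=
  \sum_(k < n) tcoef f q k *: ('X - (set_val q)%:C%:P) ^+ k.

Lemma taylorE f q n x : (taylor f q n).[(set_val x)%:C] =
  \sum_(k < n) tcoef f q k * shift q x ^+ k.
Proof.
rewrite /taylor horner_sum; apply: eq_bigr => k _.
by rewrite !hornerE /shift rmorphB.
Qed.

Lemma deriv_taylor f q n : (taylor f q n.+1)^`() = taylor (I_derive f) q n.
Proof.
rewrite /taylor big_ord_recl derivD linear_sum /= expr0 derivZ derivC scaler0 add0r.
apply: eq_bigr => k _; rewrite /bump !add1n derivZ deriv_exp derivXsubC mul1r.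
rewrite -scaler_nat scalerA; congr (_ *: _).
rewrite /tcoef /I_derive_n -iterSr factS natrM invfM.
rewrite -!mulrA; congr (_ * _); rewrite mulrA -[RHS]mul1r.
by rewrite mulrAC mulVf ?mul1r // pnatr_eq0.
Qed.

Lemma has_derivB f g x (l m : R[i]^o) : has_deriv f x l -> has_deriv g x m ->
  has_deriv (fun y => f y - g y) x (l - m).
Proof.
move=> fl gm e e0; have e20 : 0 < e / 2 by rewrite divr_gt0.
have [d d0 fd] := fl _ e20; have [d' d'0 gd] := gm _ e20.
exists (Num.min d d'); first by rewrite lt_min d0.
move=> y; rewrite lt_min => /andP[/fd{}fd /gd{}gd].
rewrite (_ : _ - _ - _ = (f y - f x - l * (set_val y - set_val x)%:C)
   - (g y - g x - m * (set_val y - set_val x)%:C)); last by ring.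
apply: (le_trans (normcD _ _)); rewrite normc_opp [e]splitr mulrDl.
exact: lerD.
Qed.

Lemma I_smooth_derive f : I_smooth f -> I_smooth (I_derive f).
Proof. by move=> sf n x; have := sf n.+1 x; rewrite /I_derive_n iterSr. Qed.

(** The derivative of the remainder of order n+1 of [f] is the remainder of order n of its
    derivative, so [mean_value_pow] gains one power at each induction step. The factor 1/n! is given
    up. *)
Lemma taylor_bound n f q (C : R) : I_smooth f ->
    (forall x, normc (I_derive_n n f x) <= C) ->
  forall x, normc (f x - (taylor f q n).[(set_val x)%:C])
    <= C * normc (shift q x) ^+ n.
Proof.
elim: n f => [|n IH] f sf fC x.
  by rewrite taylorE big_ord0 subr0 expr0 mulr1; exact: fC.
have sf' := I_smooth_derive sf.
pose g y : R[i]^o := f y - poly_fun (taylor f q n.+1) y.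
pose g' y : R[i]^o := I_derive f y - poly_fun (taylor (I_derive f) q n) y.
rewrite normc_shift; apply: (@mean_value_pow _ g g').
- move=> y; apply: has_derivB; first exact/I_derivable_has/(sf 0%N).
  by rewrite /poly_fun -deriv_taylor; exact: has_deriv_poly.
- rewrite /g /poly_fun taylorE big_ord_recl big1 => [|k _].
    by rewrite expr0 mulr1 addr0 /tcoef fact0 divr1 subrr.
  by rewrite /shift subrr /bump /= exprS mul0r mulr0.
- move=> y; rewrite -normc_shift; apply: IH => // z.
  by have := fC z; rewrite /I_derive_n iterSr.
Qed.

Variable M : weight_sequence R.

Lemma D_derive_bound f n x : f \in in_D M ->
  normc (I_derive_n n f x) <= M n * fine (D_norm M f).
Proof.
move=> /asboolP[sf Df].
have DE : D_norm M f \is a fin_num by rewrite ge0_fin_numE // D_norm_ge0.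
rewrite -lee_fin EFinM fineK // -lee_pdivrMl ?weight_gt0 // muleC.
have : (sup_norm (I_derive_n n f) * (M n)^-1%:E <= D_norm M f)%E.
  rewrite /D_norm (@nneseries_split _ _ 0%N n.+1); last first.
    by move=> k _; exact: D_term_ge0.
  rewrite add0n big_nat_recr //= -addeA addeC -addeA leeDl //.
  by rewrite adde_ge0 // ?nneseries_ge0 ?sume_ge0 // => *; exact: D_term_ge0.
apply: le_trans; apply: lee_wpmul2r; last exact: sup_norm_ub.
by rewrite lee_fin invr_ge0 ltW // weight_gt0.
Qed.

Lemma tcoef_bound f q n : f \in in_D M ->
  normc (tcoef f q n) <= M n / n`!%:R * fine (D_norm M f).
Proof.
move=> Df; rewrite /tcoef normcM normcV mulrAC.
have -> : n`!%:R = (n`!%:R : R)%:C :> R[i] by rewrite rmorph_nat.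
rewrite normc_real ger0_norm // ler_wpM2r ?invr_ge0 //.
exact: D_derive_bound.
Qed.

Lemma vanish_taylor f q n : f \in in_D M ->
  vanish n q (fun x => f x - \sum_(k < n) tcoef f q k * shift q x ^+ k).
Proof.
move=> Df; exists (M n * fine (D_norm M f)) => x; rewrite -taylorE.
apply: taylor_bound; first by move/asboolP: Df => [].
by move=> y; exact: D_derive_bound.
Qed.

Lemma tcoef_eq0 f q n (C : R) : f \in in_D M ->
    (forall e : R, 0 < e -> exists2 x, 0 < normc (shift q x) < e &
      normc (f x) <= C * normc (shift q x) ^+ n) ->
  forall k, (k < n)%N -> tcoef f q k = 0.
Proof.
move=> Df fC; have [D fD] := vanish_taylor q n Df.
apply: (@poly_coef_eq0 _ q _ (C + D)) => e e0.
have [x xe xC] := fC e e0; exists x => //.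
set P := \sum_(k < n) _; rewrite -[P](subKr (f x)) mulrDl.
by apply: (le_trans (normcD _ _)); rewrite normc_opp lerD.
Qed.

(** Zeros accumulating at [q] annihilate every Taylor coefficient there, and only the remainder is
    left. *)
Lemma vanish_all_of_zeros f q : f \in in_D M ->
    (forall e : R, 0 < e ->
      exists2 x, 0 < normc (shift q x) < e & f x = 0) ->
  forall n, vanish n q f.
Proof.
move=> Df f0 n; have [C fC] := vanish_taylor q n Df; exists C => x.
have := fC x; rewrite big1 ?subr0 // => k _.
rewrite (@tcoef_eq0 f q n 0) ?mul0r // => e /f0[y ye fy]; exists y => //.
by rewrite fy normc0 mul0r.
Qed.

Lemma shift_accumulation q (e : R) : 0 < e ->
  exists x, 0 < normc (shift q x) < e.
Proof.
move=> e0; have [x xq qx] := I_accumulation q e0; exists x.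
by rewrite normc_shift_gt0 xq normc_shift.
Qed.

(** The Taylor coefficients below n are zero, so [tcoef f q n] is the coordinate of [f] on the line
    V_n / V_(n+1). *)
Lemma vanish_lead f q n : f \in in_D M -> vanish n q f ->
  vanish n.+1 q (fun x => f x - tcoef f q n * shift q x ^+ n).
Proof.
move=> Df [C fC]; have [D fD] := vanish_taylor q n.+1 Df; exists D => x.
have := fD x; rewrite big_ord_recr big1 /= ?add0r // => k _.
rewrite (@tcoef_eq0 f q n C) ?mul0r // => e /(shift_accumulation q)[y ye].
by exists y.
Qed.

Lemma vanish_shift_eq0 q n (a : R[i]) :
  vanish n.+1 q (fun x => a * shift q x ^+ n) -> a = 0.
Proof.
move=> [C aC].
have := @poly_coef_eq0 n.+1 q (fun k => if k == n then a else 0) C.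
move=> /(_ _ n); rewrite eqxx; apply=> // e /(shift_accumulation q)[x xe].
exists x => //; rewrite big_ord_recr big1 /= ?add0r ?eqxx // => k _.
by rewrite ltn_eqF ?mul0r.
Qed.

End Taylor.

(** * Consequences of compactness for sequences in the unit ball *)

(** A cluster point of the image filter, in sequential form. The bound [n0] allows two close images
    to be picked at different indices. *)
Lemma compact_operator_cluster (K : numFieldType) (X Y : normedModType K)
    (T : {linear X -> Y}) (u : nat -> X) :
    compact_operator T -> (forall n, `|u n| <= 1) ->
  exists p, forall (e : K) n0, 0 < e ->
    exists2 n, (n0 <= n)%N & `|p - T (u n)| < e.
Proof.
move=> Tc u1; have [|p [_ pc]] := Tc (T (u n) @[n --> \oo]) _.
  exists 0%N => // n _; apply: subset_closure; exists (u n) => //.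
  exact: u1.
exists p => e n0 e0.
have Un0 : (T (u n) @[n --> \oo]) [set T (u n) | n in [set n | (n0 <= n)%N]].
  by exists n0 => // n /= n0n; exists n.
have [z [[n /= n0n <-]]] := pc _ _ Un0 (nbhsx_ballx p e e0).
by rewrite -ball_normE; exists n.
Qed.

Lemma linear_scaleB (K : pzRingType) (X Y : lmodType K) (T : {linear X -> Y})
  (a : K) (x y : X) : T (a *: x) - T (a *: y) = a *: (T x - T y).
Proof. by rewrite scalerBr !linearZ. Qed.

Section Spectrum.
Variables (R : realType) (M : weight_sequence R).
Local Notation I := (unit_interval R).
Local Notation D := (Dspace M).
Local Notation N f := (fine (D_norm M f)).

Lemma Dspace_normE (f : D) : `|f| = real_complex R (N f).
Proof. by []. Qed.

Lemma N_ge0 (f : D) : 0 <= N f.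
Proof. by apply: fine_ge0; exact: D_norm_ge0. Qed.

Lemma N_scale (a : R[i]) (f : D) : N (a *: f) = normc a * N f.
Proof.
by have := normrZ a f; rewrite !Dspace_normE normrcE -rmorphM /= => /complexI.
Qed.

Lemma N_sub (f g : D) : N (f - g) <= N f + N g.
Proof. by have := ler_normB f g; rewrite !Dspace_normE -rmorphD lecR. Qed.

(* For complete spaces this is equivalent to compactness of [S]. *)
Definition no_separated_image (S : D -> D) : Prop :=
  forall (u : nat -> D) (e : R), (forall n, N (u n) <= 1) -> 0 < e ->
    exists m n, (m < n)%N /\ N (S (u m) - S (u n)) < e.

Variable T : {linear D -> D}.
Hypothesis Tc : compact_operator T.

Lemma compact_cluster (u : nat -> D) : (forall n, N (u n) <= 1) ->
  exists p : D, forall (e : R) n0, 0 < e ->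
    exists2 n, (n0 <= n)%N & N (p - T (u n)) < e.
Proof.
move=> u1; have [|p pu] := compact_operator_cluster Tc (u := u).
  by move=> n; rewrite Dspace_normE lecR.
exists p => e n0 e0; have [|n n0n] := pu e%:C n0; first by rewrite ltcR.
by rewrite Dspace_normE ltcR; exists n.
Qed.

Lemma compact_no_separated_image : no_separated_image T.
Proof.
move=> u e u1 e0; have [p pu] := compact_cluster u1.
have e20 : 0 < e / 2 by rewrite divr_gt0.
have [m _ pm] := pu _ 0%N e20; have [n mn pn] := pu _ m.+1 e20.
exists m, n; split=> //.
rewrite (_ : T (u m) - T (u n) = (p - T (u n)) - (p - T (u m))); last first.
  by rewrite opprB [RHS]addrC addrA subrK.
by apply: (le_lt_trans (N_sub _ _)); rewrite [e]splitr ltrD.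
Qed.

(** Otherwise the unit ball contains [u n] with N (T (u n)) > n, and these images cannot come back
    near a fixed [p] at arbitrarily large indices. *)
Lemma compact_bounded_operator :
  exists2 k : R, 0 < k & forall f : D, N f <= 1 -> N (T f) <= k.
Proof.
apply/not_exists2P => Tk.
have /choice[u uP] : forall n : nat, exists f : D, N f <= 1 /\ n%:R < N (T f).
  move=> n; have [|/existsNP[f /not_implyP[f1 /negP fn]]] := Tk n.+1%:R.
    by rewrite ltr0Sn.
  exists f; split=> //; rewrite ltNge; apply: contra fn => fn.
  by apply: (le_trans fn); rewrite ler_nat.
have [|p pu] := compact_cluster (u := u); first by move=> n; case: (uP n).
have [n0 n0p] : exists n0 : nat, N p + 1 < n0%:R.
  exists (Num.bound (N p + 1)); apply: le_lt_trans (archi_boundP _); first exact: lexx.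
  by rewrite addr_ge0 ?N_ge0.
have [n n0n pn] := pu 1 n0 ltr01.
have : N (T (u n)) <= N p + N (p - T (u n)).
  rewrite -{1}[T (u n)](subKr p); exact: N_sub.
have [_] := uP n; have : n0%:R <= n%:R :> R by rewrite ler_nat.
by move: pn n0p; lra.
Qed.

(** Divided by a bound [k] of [T], the vectors [T (u n)] lie in the unit ball again, and the
    property of [T] applies to them with tolerance [e / k]. *)
Lemma compact_sq_no_separated_image : no_separated_image (T \o T).
Proof.
move=> u e u1 e0; have [k k0 Tk] := compact_bounded_operator.
have kn0 : k%:C != 0 :> R[i] by rewrite fmorph_eq0 gt_eqF.
have nk : normc k%:C = k by rewrite normc_real gtr0_norm.
have [n|m [n [mn H]]] := @compact_no_separated_image
    (fun n => (k%:C)^-1 *: T (u n)) (e / k) _ (divr_gt0 e0 k0).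
  by rewrite N_scale normcV nk ler_pdivrMl // mulr1 Tk.
exists m, n; split=> //; move: H.
rewrite linear_scaleB N_scale normcV nk.
by rewrite ltr_pdivlMr // mulrAC mulVf ?mul1r // gt_eqF.
Qed.

End Spectrum.

(** * Composition acting on the filtration V_n at a fixed point *)

Section Composition.
Variables (R : realType) (M : weight_sequence R).
Local Notation I := (unit_interval R).
Local Notation D := (Dspace M).
Local Notation N f := (fine (D_norm M f)).
Variable psi : I -> I.
Hypothesis psiD : induces_endomorphism M psi.

Definition val_psi x : R[i]^o := (set_val (psi x))%:C.

(** The map [psi] is the image of the coordinate function under composition; all its regularity
    comes from here. *)
Lemma val_psi_in_D : val_psi \in in_D M.
Proof.
rewrite (_ : val_psi = poly_fun 'X \o psi); first exact/psiD/poly_fun_in_D.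
by apply/funext => x; rewrite /= /poly_fun hornerX.
Qed.

Lemma psi_continuous x (e : R) : 0 < e -> exists2 d : R, 0 < d &
  forall y, `|set_val x - set_val y| < d -> `|set_val (psi x) - set_val (psi y)| < e.
Proof.
move=> e0; have [C [C0 H]] : exists C : R, 0 <= C /\ forall y,
    normc (val_psi y - val_psi x) <= C * normc (shift x y).
  have [C] := vanish_taylor x 1 val_psi_in_D.
  move=> H; exists `|C|; split=> // y.
  have := H y; rewrite big_ord1 expr0 mulr1 /tcoef fact0 divr1 expr1.
  by move=> /le_trans; apply; rewrite ler_wpM2r ?normc_ge0 // ler_norm.
have N0 : 0 < C + 1 by rewrite ltr_wpDl.
exists (e / (C + 1)); first by rewrite divr_gt0.
move=> y; rewrite ltr_pdivlMr // => xy; have := H y.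
rewrite normc_shift /val_psi -rmorphB normc_real distrC => /le_lt_trans; apply.
by have := normr_ge0 (set_val x - set_val y : R); move: xy; nra.
Qed.

Variable q : I.
Hypothesis psiq : psi q = q.

(** As 1! = 1, this is the derivative of [psi] at [q]. *)
Definition multiplier : R[i] := tcoef val_psi q 1.
Local Notation c := multiplier.

Lemma vanish_psi : vanish 2 q (fun x => shift q (psi x) - c * shift q x).
Proof.
have [C H] := vanish_taylor q 2 val_psi_in_D; exists C => x; have := H x.
rewrite big_ord_recl big_ord1 expr0 mulr1 expr1.
have -> : tcoef val_psi q 0 = (set_val q)%:C.
  by rewrite /tcoef fact0 divr1 /I_derive_n /= /val_psi psiq.
by rewrite opprD addrA {1}/val_psi -rmorphB.
Qed.

Lemma vanishM m n (f g : I -> R[i]) : vanish m q f -> vanish n q g ->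
  vanish (m + n) q (fun x => f x * g x).
Proof.
move=> [A fA] [B gB]; exists (A * B) => x.
rewrite normcM exprD mulrACA ler_pM ?normc_ge0 //.
Qed.

Lemma eq_vanish n (f g : I -> R[i]) : f =1 g -> vanish n q f -> vanish n q g.
Proof. by move=> /funext ->. Qed.

Lemma psi_lipschitz :
  exists2 L : R, 0 <= L & forall x, normc (shift q (psi x)) <= L * normc (shift q x).
Proof.
have : vanish 1 q (shift q \o psi).
  have := vanishP 1 c (vanish_le (isT : 1 <= 2)%N vanish_psi) (vanish_shift 1 q).
  by apply: eq_vanish => x; rewrite expr1 mul1r subrK.
by move=> /vanish_ge0[L L0 H]; exists L => // x; rewrite -[_ (shift q x)]expr1.
Qed.

Lemma vanish_comp n f : vanish n q f -> vanish n q (f \o psi).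
Proof.
move=> /vanish_ge0[C C0 fC]; have [L L0 HL] := psi_lipschitz.
exists (C * L ^+ n) => x; apply: (le_trans (fC _)).
rewrite -mulrA ler_wpM2l // -exprMn; apply: lerXn2r => //; rewrite nnegrE.
  exact: normc_ge0.
by rewrite mulr_ge0 ?normc_ge0.
Qed.

(** With s the shift and s' = s o psi, the induction rests on s'^(n+1) - c^(n+1) s^(n+1) = s' (s'^n
    - c^n s^n) + c^n (s' - c s) s^n. *)
Lemma vanish_comp_shift n :
  vanish n.+1 q (fun x => shift q (psi x) ^+ n - c ^+ n * shift q x ^+ n).
Proof.
elim: n => [|n IH].
  by exists 0 => x; rewrite !expr0 mulr1 subrr normc0 mul0r.
have u1 : vanish 1 q (fun x => shift q (psi x)).
  exact: (@vanish_comp 1 (fun x => shift q x) (vanish_shift 1 q)).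
have := vanishP 1 (c ^+ n) (vanishM u1 IH) (vanishM vanish_psi (vanish_shift n q)).
by apply: eq_vanish => x; rewrite !exprS; ring.
Qed.

(** Write [f] as a s^n + r with s the shift and r in V_(n+1): the monomial is handled by
    [vanish_comp_shift], and V_(n+1) is stable under composition. *)
Lemma vanish_comp_lead n f : f \in in_D M -> vanish n q f ->
  vanish n.+1 q (fun x => f (psi x) - c ^+ n * f x).
Proof.
move=> Df fn; have r := vanish_lead Df fn; set a := tcoef f q n in r.
have := vanishP 1 (- c ^+ n) (vanish_comp r) r.
move=> /(vanishP a 1 (vanish_comp_shift n)).
by apply: eq_vanish => x /=; ring.
Qed.

Definition shiftX n : D := MkDspace (poly_fun_in_D M (('X - (set_val q)%:C%:P) ^+ n)).

Lemma shiftXE n x : shiftX n x = shift q x ^+ n.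
Proof. by rewrite /= /poly_fun !hornerE /shift rmorphB. Qed.

(** Riesz argument: if |c| >= 1, unit-ball vectors f_n of V_n that stay at distance at least 1/2
    from V_(n+1) have images at mutual distance at least 1/2. *)
Lemma multiplier_lt1 : no_separated_image (comp_endo psiD) -> normc c < 1.
Proof.
move=> Ssep; rewrite ltNge; apply/negP => c1.
(* [f n] almost realises the distance from [shiftX n] to the functions
   vanishing to order [n.+1]. *)
have /choice[f fP] : forall n, exists f : D,
    [/\ N f <= 1, vanish n q f & forall (a : R[i]) (g : D),
      1 <= normc a -> vanish n.+1 q g -> 1 / 2 <= N (a *: f + g)].
  move=> n.
  pose A := [set r : R | exists2 g : D, vanish n.+1 q g & r = N (shiftX n + g)].
  pose K := M n / n`!%:R.
  have K0 : 0 < K by rewrite divr_gt0 ?weight_gt0 // ltr0n fact_gt0.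
  (* Adding an element of V_(n+1) does not change the n-th coefficient. By [tcoef_bound] the whole
     coset then has norm at least n! / M_n, so the distance [inf A] is positive. *)
  have tc1 (g : D) : vanish n.+1 q g -> tcoef (shiftX n + g) q n = 1.
    move=> gn.
    have wn : vanish n q (shiftX n + g : D).
      have := vanishP 1 1 (vanish_shift n q) (vanish_le (leqnSn n) gn).
      by apply: eq_vanish => x; rewrite !mul1r -shiftXE.
    have := vanishP 1 (-1) (vanish_lead (D_funP _) wn) gn.
    set t := tcoef _ _ _ => tn; apply/eqP; rewrite eq_sym -subr_eq0; apply/eqP.
    apply: (@vanish_shift_eq0 _ q n); move: tn; apply: eq_vanish => x.
    rewrite (_ : (shiftX n + g : D) x = shiftX n x + g x) // shiftXE.
    by ring.
  have Alb : lbound A (K^-1).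
    move=> _ [g gn ->]; rewrite -[leLHS]mulr1 ler_pdivrMl //.
    have := tcoef_bound q n (D_funP (shiftX n + g)); rewrite tc1 // normc1.
    exact.
  have V0 : vanish n.+1 q (0 : D) by exists 0 => x; rewrite normc0 mul0r.
  have A0 : A !=set0 by exists (N (shiftX n + 0)), 0.
  have infA : has_inf A by split=> //; exists K^-1.
  have i0 : 0 < inf A.
    by apply: lt_le_trans (lb_le_inf A0 Alb); rewrite invr_gt0.
  (* With [inf A] itself as tolerance, the norm of [w] is below 2 [inf A]; this is the origin of the
     constant 1/2. *)
  have [_ [g gn ->] gi] := inf_adherent i0 infA.
  set w := shiftX n + g in gi.
  have w0 : 0 < N w.
    apply: (lt_le_trans i0); apply: ge_inf; first by exists K^-1.
    by exists g.
  have nw : normc (N w)%:C = N w by rewrite normc_real gtr0_norm.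
  have wC : (N w)%:C != 0 :> R[i] by rewrite fmorph_eq0 gt_eqF.
  exists ((N w)%:C^-1 *: w); split.
  - by rewrite N_scale normcV nw mulVf // gt_eqF.
  - have := vanishP ((N w)%:C^-1) ((N w)%:C^-1) (vanish_shift n q)
      (vanish_le (leqnSn n) gn).
    apply: eq_vanish => x; rewrite -shiftXE -mulrDr.
    by [].
  - move=> a k a1 kn.
    have a0 : a != 0 by rewrite -normc_gt0 (lt_le_trans ltr01).
    have -> : a *: ((N w)%:C^-1 *: w) + k =
        (a / (N w)%:C) *: (shiftX n + (g + ((N w)%:C / a) *: k)).
      rewrite addrA -/w [RHS]scalerDr !scalerA mulrA divfK // divff //.
      by rewrite scale1r.
    rewrite N_scale normcM normcV nw -mulrA.
    apply: (@le_trans _ _ (1 * (1 / 2))); first lra.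
    apply: ler_pM => //; rewrite ler_pdivlMl //.
    apply: (@le_trans _ _ (inf A)).
      by move: gi; lra.
    apply: ge_inf; first by exists K^-1.
    exists (g + ((N w)%:C / a) *: k) => //.
    have := vanishP 1 ((N w)%:C / a) gn kn.
    by apply: eq_vanish => x; rewrite mul1r.
have f1 n : N (f n) <= 1 by case: (fP n).
have fn n : vanish n q (f n) by case: (fP n).
have h0 : 0 < 1 / 2 :> R by lra.
have [m [n [mn]]] := Ssep f (1 / 2) f1 h0.
apply/negP; rewrite -leNgt.
set S := comp_endo psiD.
(* The bracket lies in V_(m+1): [S] acts as c^m modulo V_(m+1), and [S (f n)] is in V_n with m <
   n. *)
have -> : S (f m) - S (f n) = c ^+ m *: f m + (S (f m) - c ^+ m *: f m - S (f n)).
  by rewrite addrA addrCA subrr addr0.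
have [_ _] := fP m; apply; first by rewrite normcX exprn_ege1.
have := vanishP 1 (-1) (vanish_comp_lead (D_funP (f m)) (fn m))
  (vanish_le mn (vanish_comp (fn n))).
by apply: eq_vanish => x; rewrite mul1r mulN1r.
Qed.

End Composition.

(** * Flat eigenfunctions vanish near an attracting fixed point *)

Section LocalUniqueness.
Variables (R : realType) (M : weight_sequence R).
Local Notation I := (unit_interval R).
Local Notation D := (Dspace M).
Variables (psi : I -> I) (q : I).
Hypotheses (psiD : induces_endomorphism M psi) (psiq : psi q = q).
Local Notation c := (multiplier psi q).

Lemma exp_lt_eps (r e : R) : 0 <= r < 1 -> 0 < e -> exists n, r ^+ n < e.
Proof.
move=> /andP[r0 r1] e0; have r1' : `|r| < 1 by rewrite ger0_norm.
have /cvgrPdist_lt/(_ _ e0)[n _ /(_ n (leqnn n))/=] := cvg_expr r1'.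
by rewrite sub0r normrN ger0_norm ?exprn_ge0 //; exists n.
Qed.

Lemma psi_contracts : normc c < 1 -> exists r : R, 0 <= r < 1 /\
  exists2 d : R, 0 < d & forall x, normc (shift q x) < d ->
    normc (shift q (psi x)) <= r * normc (shift q x).
Proof.
move=> c1; have c0 := normc_ge0 c.
have [C C0 H] := vanish_ge0 (vanish_psi psiD psiq).
have N0 : 0 < 2 * (C + 1) by lra.
(* The rate is the midpoint of |c| and 1; the radius below makes the quadratic error at most (1 -
   |c|) / 2 times the distance to [q]. *)
exists ((normc c + 1) / 2); split; first by lra.
exists ((1 - normc c) / (2 * (C + 1))); first by rewrite divr_gt0 // subr_gt0.
move=> x; rewrite ltr_pdivlMr // => xd.
rewrite -[shift q (psi x)](subrK (c * shift q x)).
apply: (le_trans (normcD _ _)); rewrite normcM.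
have := H x; have := normc_ge0 (shift q x); rewrite expr2.
by move: xd; nra.
Qed.

(** Let r be the contraction rate and choose n with r^n < |mu| / 2. Each use of f y = f (psi y) / mu
    halves the constant in the bound of order n, so the constant can be brought down to 0. *)
Lemma flat_eigen_local (f : I -> R[i]) (mu : R[i]) : normc c < 1 -> mu != 0 ->
    (forall x, f (psi x) = mu * f x) -> (forall n, vanish n q f) ->
  exists2 d : R, 0 < d & forall x, normc (shift q x) < d -> f x = 0.
Proof.
move=> c1 mu0 fmu fV; have [r [/andP[r0 r1] [d d0 H]]] := psi_contracts c1.
have m0 : 0 < normc mu by rewrite normc_gt0.
have [|n rn] := @exp_lt_eps r (normc mu / 2) _ (divr_gt0 m0 (ltr0n R 2)).
  by rewrite r0.
have [C C0 fC] := vanish_ge0 (fV n); exists d => // x xd.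
have decay k y : normc (shift q y) < d ->
    normc (f y) <= C * (1 / 2) ^+ k * normc (shift q y) ^+ n.
  elim: k y => [|k IH] y yd; first by rewrite expr0 mulr1.
  have yr := H y yd; have h0 := normc_ge0 (shift q y).
  have /IH : normc (shift q (psi y)) < d by nra.
  rewrite fmu normcM -ler_pdivlMl // => /le_trans; apply.
  rewrite ler_pdivrMl //.
  apply: (@le_trans _ _ (C * (1 / 2) ^+ k * (r ^+ n * normc (shift q y) ^+ n))).
    rewrite ler_wpM2l ?mulr_ge0 ?exprn_ge0 // -exprMn.
    by apply: lerXn2r => //; rewrite nnegrE ?normc_ge0 // mulr_ge0.
  have P0 : 0 <= C * (1 / 2) ^+ k * normc (shift q y) ^+ n.
    by rewrite !mulr_ge0 ?exprn_ge0.
  rewrite exprS; move: (ltW rn) => /(ler_wpM2l P0); set u := _ ^+ k.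
  lra.
apply/eqP/negP => /negP; rewrite -normc_gt0 => fx0.
have C10 : 0 < C + 1 by lra.
have [|k kP] := @exp_lt_eps (1 / 2) (normc (f x) / (C + 1)) _ (divr_gt0 fx0 C10).
  by lra.
have := decay k x xd.
have : normc (shift q x) ^+ n <= 1.
  by rewrite exprn_ile1 ?normc_ge0 ?normc_shift_le1.
have : 0 <= normc (shift q x) ^+ n by rewrite exprn_ge0 ?normc_ge0.
have : 0 <= (1 / 2 : R) ^+ k by rewrite exprn_ge0.
move: kP; rewrite ltr_pdivlMr //.
move: (_ ^+ k) (_ ^+ n) => u v kP u0 v0 v1.
have : C * u * v <= C * u by rewrite ler_piMr // mulr_ge0.
lra.
Qed.

End LocalUniqueness.

(** * Flat eigenfunctions vanish on all of [0, 1] *)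

Section GlobalUniqueness.
Variables (R : realType) (M : weight_sequence R).
Local Notation I := (unit_interval R).
Local Notation D := (Dspace M).
Implicit Types (x y z a b e : I).

Definition btw a b z : Prop :=
  set_val a <= set_val z <= set_val b \/ set_val b <= set_val z <= set_val a.

Lemma I_IVT (psi : I -> I) a b v : induces_endomorphism M psi ->
  btw (psi a) (psi b) v -> exists2 z, btw a b z & psi z = v.
Proof.
move=> psiD.
have cont : continuous ((set_val \o psi) \o @clamp R : R -> R).
  apply: clamp_continuous => x e e0.
  by have [d d0 H] := psi_continuous psiD x e0; exists d => // y /H/ltW.
suff main a' b' : set_val a' <= set_val b' -> btw (psi a') (psi b') v ->
    exists2 z, btw a' b' z & psi z = v.
  move=> abv; have [ab|/ltW ba] := leP (set_val a : R) (set_val b).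
    exact: main.
  have [|z zab zv] := main _ _ ba; first by case: abv; [right|left].
  by exists z => //; case: zab; [right|left].
move=> ab abv; have [|t] := IVT (v := set_val v) ab (continuous_subspaceT cont).
  rewrite /= !clampK ge_min le_max.
  by case: abv => /andP[-> ->]; rewrite ?orbT.
rewrite in_itv /= => /andP[at_ tb] tv; exists (clamp t); last exact: val_inj.
left; rewrite clampE ?at_ //.
by have := I_le1 a'; have := I_le1 b'; lra.
Qed.

Lemma psi_fixed_point (psi : I -> I) : induces_endomorphism M psi ->
  exists x, psi x = x.
Proof.
move=> psiD.
have cont : continuous ((fun x => set_val (psi x) - set_val x) \o @clamp R : R -> R).
  apply: clamp_continuous => x e e0; have e20 : 0 < e / 2 by rewrite divr_gt0.
  have [d d0 H] := psi_continuous psiD x e20; exists (Num.min d (e / 2)).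
    by rewrite lt_min d0.
  move=> y; rewrite lt_min => /andP[/H{}H xy].
  rewrite (_ : _ - _ - _ =
    (set_val (psi x) - set_val (psi y)) - (set_val x - set_val y)); last by ring.
  by apply: (le_trans (ler_normB _ _)); lra.
have [|t] := IVT (v := 0) (@ler01 R) (continuous_subspaceT cont).
  rewrite ge_min le_max /= !clampE ?lexx ?ler01 //.
  have := I_le1 (psi (clamp 0)); have := I_le1 (psi (clamp 1)).
  by move=> /andP[? ?] /andP[? ?]; apply/andP; split; apply/orP; [right|left]; lra.
move=> _ /= /eqP; rewrite subr_eq0 => /eqP E; exists (clamp t).
exact: val_inj.
Qed.

Variable phi : I -> I.
Hypothesis phiD : induces_endomorphism M phi.
Local Notation T := (comp_endo phiD).
Hypothesis Tc : compact_operator T.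
Variables (f : D) (lambda : R[i]) (x0 : I).
Hypotheses (lambda0 : lambda != 0) (fl : forall x, f (phi x) = lambda * f x).
Hypothesis (x0_fix : phi x0 = x0).

Lemma multiplier_phi_lt1 x : phi x = x -> normc (multiplier phi x) < 1.
Proof.
by move=> px; apply: (multiplier_lt1 px (compact_no_separated_image Tc)).
Qed.

Lemma phi2D : induces_endomorphism M (phi \o phi).
Proof. by move=> g /phiD/phiD. Qed.

Lemma multiplier_phi2_lt1 x : phi (phi x) = x ->
  normc (multiplier (phi \o phi) x) < 1.
Proof.
move=> px; apply: (@multiplier_lt1 _ M _ phi2D _ px).
rewrite (_ : comp_endo phi2D = T \o T :> (D -> D)).
  exact: compact_sq_no_separated_image.
by apply/funext => g; exact: val_inj.
Qed.

(** Connected sets of reals being intervals, this is membership in the component of [x0] in the zero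
    set; [zero_nbhs] below is membership in its interior. *)
Definition zero_component y : Prop := forall z, btw x0 y z -> f z = 0.

Definition zero_nbhs e : Prop :=
  exists2 d : R, 0 < d & forall y, `|set_val e - set_val y| < d -> zero_component y.

Lemma zero_component_zero e : zero_component e -> f e = 0.
Proof. by apply; rewrite /btw !lexx !andbT; case: leP; [left|move=> /ltW; right]. Qed.

(** Since [phi] fixes [x0], the image of the segment from [x0] to [e] covers the segment from [x0]
    to [phi e]. *)
Lemma zero_component_phi e : zero_component e -> zero_component (phi e).
Proof.
move=> Je z; rewrite -{1}x0_fix => /(I_IVT phiD)[y xy <-].
by rewrite fl Je ?mulr0.
Qed.

(** A point between [x0] and [y] is either between [x0] and [e] or no farther from [e] than [y]
    is. *)
Lemma zero_component_nbhs_zero e (d : R) : zero_component e -> 0 < d ->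
  (forall y, `|set_val e - set_val y| < d -> f y = 0) -> zero_nbhs e.
Proof.
move=> Je d0 fd; exists d => // y ey z xyz.
have [ez|nez] := pselect (btw x0 e z); first exact: Je.
apply: fd; apply: le_lt_trans ey.
move: xyz nez; rewrite /btw => xyz /not_orP[/negP + /negP].
rewrite !negb_and -!ltNge => n1 n2.
have [ey|/ltW ye] := leP (set_val e : R) (set_val y); [
  rewrite [leRHS]ler0_norm ?subr_le0 // | rewrite [leRHS]ger0_norm ?subr_ge0 //];
  rewrite ler_norml; move: n1 n2 => /orP[n1|n1] /orP[n2|n2];
  move: xyz => [/andP[? ?]|/andP[? ?]]; lra.
Qed.

Lemma zero_component_nbhs_phi e : zero_component e -> zero_nbhs (phi e) -> zero_nbhs e.
Proof.
move=> Je [d d0 H]; have [d' d'0 H'] := psi_continuous phiD e d0.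
apply: (zero_component_nbhs_zero Je d'0) => y /H' /H /zero_component_zero.
by rewrite fl => /eqP; rewrite mulf_eq0 (negPf lambda0) => /eqP.
Qed.

Lemma zero_component_nbhs_btw e e' : zero_component e' ->
  set_val x0 < set_val e < set_val e' \/ set_val e' < set_val e < set_val x0 ->
  zero_nbhs e.
Proof.
move=> Je' ee'.
pose d : R := Num.min `|set_val e - set_val x0| `|set_val e' - set_val e|.
have d0 : 0 < d.
  by rewrite lt_min !normr_gt0 !subr_eq0; case: ee' => /andP[? ?]; lra.
exists d => // y; rewrite lt_min => /andP[y1 y2] z xyz; apply: Je'.
move: y1 y2 xyz; case: ee' => /andP[xe ee'].
  rewrite (gtr0_norm (_ : 0 < set_val e - set_val x0)) ?subr_gt0 //.
  rewrite (gtr0_norm (_ : 0 < set_val e' - set_val e)) ?subr_gt0 //.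
  rewrite !ltr_norml => /andP[? ?] /andP[? ?].
  by move=> [/andP[? ?]|/andP[? ?]]; left; lra.
rewrite (ltr0_norm (_ : set_val e - set_val x0 < 0)) ?subr_lt0 //.
rewrite (ltr0_norm (_ : set_val e' - set_val e < 0)) ?subr_lt0 //.
rewrite !ltr_norml => /andP[? ?] /andP[? ?].
by move=> [/andP[? ?]|/andP[? ?]]; right; lra.
Qed.

Hypothesis f_flat : forall n, vanish n x0 f.

Lemma zero_component_nbhs_x0 : zero_nbhs x0.
Proof.
have [d d0 fd] := flat_eigen_local phiD x0_fix (multiplier_phi_lt1 x0_fix)
  lambda0 fl f_flat.
apply: (@zero_component_nbhs_zero x0 d) => [z xz|//|y]; last first.
  by rewrite -normc_shift; exact: fd.
have -> : z = x0.
  by apply: val_inj; apply/eqP; rewrite eq_le; case: xz => /andP[-> ->].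
by apply: fd; rewrite normc_shift subrr normr0.
Qed.

Definition boundary_point e : Prop := zero_component e /\ ~ zero_nbhs e.

Lemma boundary_phi e : boundary_point e -> boundary_point (phi e).
Proof.
move=> [Je nJ]; split; first exact: zero_component_phi.
by move/(zero_component_nbhs_phi Je).
Qed.

Lemma boundary_neq e : boundary_point e -> set_val e != set_val x0 :> R.
Proof.
move=> [_ nJ]; apply/eqP => /val_inj ex0; apply: nJ.
by rewrite ex0; exact: zero_component_nbhs_x0.
Qed.

(** If they differed, the one nearer to [x0] would lie strictly between [x0] and the other, hence in
    the interior. *)
Lemma boundary_same_side e e' : boundary_point e -> boundary_point e' ->
  (set_val x0 < set_val e) = (set_val x0 < set_val e' :> R) -> e = e'.
Proof.
move=> be be' s; apply: val_inj.
have := boundary_neq be; have := boundary_neq be'; move: be be' => [Je nJ] [Je' nJ'].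
have H a b : zero_component b -> ~ zero_nbhs a ->
    ~ (set_val x0 < set_val a < set_val b \/ set_val b < set_val a < set_val x0).
  by move=> Jb nJa ab; apply: nJa; exact: zero_component_nbhs_btw ab.
have := H _ _ Je' nJ; have := H _ _ Je nJ'.
move=> /not_orP[/negP + /negP +] /not_orP[/negP + /negP +].
rewrite !negb_and -!leNgt; move: s.
case: ltgtP => //= _; case: ltgtP => //= _ _; rewrite ?andbF ?orbF /=.
all: by move=> *; apply/eqP; rewrite eq_le; apply/andP.
Qed.

(** Zeros of [f] accumulate at [e] from the side of [x0], so [f] is flat there. Local uniqueness for
    [phi \o phi], with eigenvalue lambda^2, puts [e] in the interior. *)
Lemma boundary_not_periodic e : boundary_point e -> phi (phi e) <> e.
Proof.
move=> be pe; have ex0 := boundary_neq be; have [Je nJ] := be; apply: nJ.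
have fl2 x : f ((phi \o phi) x) = lambda ^+ 2 * f x by rewrite /= !fl mulrA.
have [d d0 fd] : exists2 d : R, 0 < d &
    forall x, normc (shift e x) < d -> f x = 0.
  apply: (flat_eigen_local phi2D pe (multiplier_phi2_lt1 pe)) fl2 _.
    by rewrite expf_neq0.
  apply: vanish_all_of_zeros (D_funP f) _ => r r0.
  pose s : R := Num.min 1 (r / 2).
  have s0 : 0 < s by rewrite lt_min ltr01 divr_gt0.
  have s1 : s <= 1 by rewrite ge_min lexx.
  have sr : s < r by rewrite gt_min; apply/orP; right; lra.
  have e1 := I_le1 e; have x1 := I_le1 x0.
  (* The point at the fraction [s] of the way from [e] to [x0]: on the segment because [s <= 1], and
     within [r] of [e] because [s < r]. *)
  pose t : R := set_val e + s * (set_val x0 - set_val e).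
  have tE : set_val (clamp t) = t by apply: clampE; rewrite /t; nra.
  exists (clamp t).
    rewrite normc_shift tE /t opprD addNKr normrN normrM (gtr0_norm s0).
    have dx : 0 < `|set_val x0 - set_val e : R|.
      by rewrite normr_gt0 subr_eq0 eq_sym.
    rewrite mulr_gt0 //=; apply: le_lt_trans sr.
    by rewrite ler_piMr ?(ltW s0) // I_dist_le1.
  apply: Je; rewrite /btw tE /t.
  have [xe|/ltW ex] := leP (set_val x0 : R) (set_val e); [left|right]; nra.
by apply: (zero_component_nbhs_zero Je d0) => y; rewrite -normc_shift; exact: fd.
Qed.

(** Two of the boundary points [e], [phi e], [phi (phi e)] are on the same side of [x0], hence
    equal; in each case [e] or [phi e] is fixed by [phi \o phi]. *)
Lemma no_boundary e : ~ boundary_point e.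
Proof.
move=> b1; have b2 := boundary_phi b1; have b3 := boundary_phi b2.
have n1 := boundary_not_periodic b1; have n2 := boundary_not_periodic b2.
have [s12|s12] := eqVneq (set_val x0 < set_val e)%R (set_val x0 < set_val (phi e))%R.
  by have E := boundary_same_side b1 b2 s12; apply: n1; rewrite -!E.
have [s23|s23] := eqVneq (set_val x0 < set_val (phi e))%R
    (set_val x0 < set_val (phi (phi e)))%R.
  by have E := boundary_same_side b2 b3 s23; apply: n2; rewrite -!E.
apply/n1/esym/(boundary_same_side b1 b3); move: s12 s23.
by do 3!case: (_ < _).
Qed.

Lemma zero_component_open e : zero_component e -> zero_nbhs e.
Proof. by move=> Je; apply/not_notP => nJ; apply: (@no_boundary e). Qed.

Lemma zero_component_closed e : ~ zero_component e ->
  exists2 d : R, 0 < d & forall y, `|set_val e - set_val y| < d -> ~ zero_component y.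
Proof.
move=> /existsNP[z /not_implyP[xez /eqP fz]].
(* If the nonzero value is taken at [e], it persists nearby by differentiability. Otherwise [z]
   still separates [x0] from every [y] closer to [e] than [z] is. *)
have [ze|ze] := eqVneq z e.
  have /asboolP[sf _] := D_funP f.
  have [d d0 H] := I_derivable_has (sf 0%N e) (@ltr01 R).
  have fe : 0 < normc (f e) by rewrite normc_gt0 -ze.
  set l := I_derive _ e in H.
  have N0 : 0 < normc l + 1 by rewrite ltr_wpDl ?normc_ge0.
  exists (Num.min d (normc (f e) / (normc l + 1))).
    by rewrite lt_min d0 divr_gt0.
  move=> y; rewrite lt_min ltr_pdivlMr // => /andP[/H{}H ey] /zero_component_zero fy.
  move: H; rewrite /I_derive_n /= fy sub0r -opprD normc_opp mul1r => H.
  have := normcD (f e + l * (set_val y - set_val e)%:C)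
    (- (l * (set_val y - set_val e)%:C)).
  by rewrite addrK normc_opp [normc (l * _)]normcM normc_real distrC; move: H ey; lra.
have ez0 : 0 < `|set_val e - set_val z : R| by rewrite I_dist_gt0.
exists `|set_val e - set_val z| => // y ey Jy; case/negP: fz; apply/eqP/Jy.
move: ey; rewrite I_dist_gt0 in ez0.
have {}ze : set_val z != set_val e :> R.
  by apply: contra_neq ze; exact: val_inj.
case: xez => /andP[xz ze'].
  have {ze ze'} : set_val z < set_val e by rewrite lt_neqAle ze.
  move=> ze; rewrite [ltRHS]gtr0_norm ?subr_gt0 // ltr_norml => /andP[? ?].
  by left; lra.
have {ze xz} : set_val e < set_val z by rewrite lt_neqAle eq_sym ze.
move=> ze; rewrite [ltRHS]ltr0_norm ?subr_lt0 // ltr_norml => /andP[? ?].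
by right; lra.
Qed.

(** Pulled back to the line by [clamp], the component of [x0] is open and closed and meets the
    connected set [0, 1]. *)
Lemma flat_eigen_eq0 x : f x = 0.
Proof.
apply: zero_component_zero; pose C := [set t : R | zero_component (clamp t)].
have A0 : (`[0 : R, 1] `&` C) !=set0.
  exists (set_val x0); split; first exact: I_le1.
  rewrite /C /= clampK => z; have [d d0] := zero_component_nbhs_x0.
  by apply; rewrite subrr normr0.
have oC : open C.
  rewrite openE => t /zero_component_open[d d0 H].
  apply/nbhs_ballP; exists d => // s ts.
  by apply: H; exact: le_lt_trans (clamp_dist _ _) ts.
have cC : closed C.
  rewrite -openC openE => t /zero_component_closed[d d0 H].
  apply/nbhs_ballP; exists d => // s ts.
  by apply: H; exact: le_lt_trans (clamp_dist _ _) ts.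
have := segment_connected A0 (ex_intro2 _ _ C oC erefl) (ex_intro2 _ _ C cC erefl).
move=> /seteqP[_ /(_ (set_val x))]; rewrite /C /= clampK.
by case; first exact: I_le1.
Qed.

End GlobalUniqueness.

(** * Orders of vanishing of eigenfunctions and the dimension count *)

Section Eigenfunctions.
Variables (R : realType) (M : weight_sequence R).
Local Notation I := (unit_interval R).
Variables (psi : I -> I) (q : I).
Hypotheses (psiD : induces_endomorphism M psi) (psiq : psi q = q).
Local Notation c := (multiplier psi q).

(** By [vanish_comp_lead], (mu - c^n) f lies in V_(n+1); a nonzero factor could be divided out. *)
Lemma eigen_multiplier n (f : I -> R[i]^o) (mu : R[i]) : f \in in_D M ->
    (forall x, f (psi x) = mu * f x) -> vanish n q f -> ~ vanish n.+1 q f ->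
  mu = c ^+ n.
Proof.
move=> Df fmu fn nfn; apply/eqP; rewrite -subr_eq0; apply/negP => /negP m0.
apply: nfn; have H := vanish_comp_lead psiD psiq Df fn.
have := vanishP (mu - c ^+ n)^-1 0 H H; apply: eq_vanish => x.
by rewrite mul0r addr0 fmu -mulrBl mulKf.
Qed.

Lemma vanish_first_failure (f : I -> R[i]^o) : f \in in_D M ->
  ~ (forall n, vanish n q f) -> exists n, vanish n q f /\ ~ vanish n.+1 q f.
Proof.
move=> Df nV; apply/not_existsP => H; apply: nV; elim=> [|n IH].
  (* Order 0 means boundedness, which holds for all of D, so the induction can start. *)
  exists (M 0%N * fine (D_norm M f)) => x; rewrite expr0 mulr1.
  exact: (D_derive_bound 0 x Df).
by apply/not_notP => nf; exact: (H n).
Qed.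

End Eigenfunctions.

Lemma expr_inj_lt1 (R : realDomainType) (r : R) m n :
  0 <= r < 1 -> r ^+ m != 0 -> r ^+ m = r ^+ n -> m = n.
Proof.
move=> /andP[r0 r1].
wlog mn : m n / (m <= n)%N => [wl|] rm E.
  have [|/ltnW nm] := leqP m n; first by move=> /wl; exact.
  by apply/esym/wl => //; rewrite -E.
apply/eqP; rewrite eqn_leq mn leqNgt; apply/negP => {}mn.
have : r ^+ (n - m) = 1.
  by apply: (mulfI rm); rewrite -exprD mulr1 subnKC // ltnW.
apply/eqP; rewrite lt_eqF // exprn_ilt1 // -lt0n subn_gt0 //.
Qed.

Theorem theorem2p5 (R : realType) (M : weight_sequence R)
    (phi : unit_interval R -> unit_interval R)
    (phiD : induces_endomorphism M phi)
    (Tcompact : compact_operator (comp_endo phiD))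
    (lambda : R[i]) (lambda_neq0 : lambda != 0)
    (lambda_eigen : op_eigenvalue (comp_endo phiD) lambda) :
  has_dimension (op_eigenspace (comp_endo phiD) lambda) 1.
Proof.
have [f f0 fE] := lambda_eigen.
have [x0 px0] := psi_fixed_point phiD.
set c := multiplier phi x0.
have c1 : 0 <= normc c < 1.
  by rewrite normc_ge0 (multiplier_phi_lt1 Tcompact px0).
have eigenE (g : Dspace M) : comp_endo phiD g = lambda *: g ->
    forall x, g (phi x) = lambda * g x.
  by move=> gE x; rewrite -[RHS]/((lambda *: g : Dspace M) x) -gE.
have order (g : Dspace M) : comp_endo phiD g = lambda *: g -> g != 0 ->
    exists n, [/\ vanish n x0 g, ~ vanish n.+1 x0 g & lambda = c ^+ n].
  move=> /eigenE gE g0; have [|n [gn ngn]] := vanish_first_failure (D_funP g) (q := x0).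
    move=> gV; case/eqP: g0; apply/val_inj/funext => x.
    exact: (flat_eigen_eq0 Tcompact lambda_neq0 gE px0 gV).
  by exists n; split=> //; apply: (eigen_multiplier phiD px0 (D_funP g) gE gn ngn).
have [N [fN nfN cN]] := order _ fE f0.
(* Moduli suffice: |c| < 1, and |c|^N = |lambda| is nonzero. *)
have order_uniq n : lambda = c ^+ n -> n = N.
  move=> cn; apply: (expr_inj_lt1 c1); rewrite -!normcX -cn ?cN //.
  by rewrite -cN gt_eqF // normc_gt0.
have multiple (g : Dspace M) : comp_endo phiD g = lambda *: g ->
    exists a : R[i], g = a *: f.
  move=> gE.
  have gN : vanish N x0 g.
    have [->|g0] := eqVneq g 0; first by exists 0 => x; rewrite normc0 mul0r.
    by have [n [gn _ /order_uniq <-]] := order _ gE g0.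
  have lf := vanish_lead (D_funP f) fN; have lg := vanish_lead (D_funP g) gN.
  set a := tcoef f x0 N in lf; set b := tcoef g x0 N in lg.
  have a0 : a != 0.
    apply/eqP => a0; apply: nfN; move: lf; apply: eq_vanish => x.
    by rewrite a0 mul0r subr0.
  (* This ratio cancels the leading terms at [x0], so the difference lies in V_(N+1), whereas a
     nonzero eigenfunction has order exactly [N]. *)
  exists (b / a); apply/eqP; rewrite -subr_eq0; apply/negP => /negP d0.
  have dE : comp_endo phiD (g - (b / a) *: f) = lambda *: (g - (b / a) *: f).
    by rewrite linearB linearZ /= gE fE scalerBr !scalerA mulrC.
  have [n [_ + /order_uniq nN]] := order _ dE d0; apply; rewrite nN.
  have := vanishP 1 (- (b / a)) lg lf; apply: eq_vanish => x.
  rewrite -[RHS]/(g x - (b / a) * f x).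
  by field.
exists (fun=> f); split.
- move=> k _; rewrite big_ord1 /op_eigenspace /=.
  by rewrite linearZ /= fE !scalerA mulrC.
- move=> k l _ _; rewrite !big_ord1 => kl; apply/ffunP => i; rewrite (ord1 i).
  apply/eqP; rewrite -subr_eq0; move/eqP: kl; rewrite -subr_eq0 -scalerBl.
  by rewrite scaler_eq0 (negPf f0) orbF.
- move=> g /multiple[a ->]; exists [ffun=> a] => //.
  by rewrite big_ord1 ffunE.
Qed.
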